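(* It is not always true that Complete Sequence Multiplications of the same operands in different orders are permutationally equivalent. That is, there exist a nonempty finite set $S=\{o_1,\dots,o_n\}$ of OIE instances (with an infeasibility assignment satisfying the standing axiom) and two index tuples $(i_1,\dots,i_n)$, $(j_1,\dots,j_n)$ of length $n$ such that $\otimes(o_{i_1},\dots,o_{i_n})$ and $\otimes(o_{j_1},\dots,o_{j_n})$ are not permutationally equivalent via any permutation matrix.
   Context: Times are real numbers; a ''2-tuple'' is a pair $(x,y)$ of reals with $x<y$ (starting and ending timestamp). For a nonempty finite tuple of 2-tuples $T=((x_1,y_1),\dots,(x_m,y_m))$ put $\mathrm{bound}(T)=(\min_i x_i,\max_i y_i)$. An OIE (Optional Intervals Event) instance is a 4-tuple $o=(\mathcal C_o,\mathcal F_o,\mathcal I_o,\mathcal A_o)$ where $\mathcal C_o$ is a finite (possibly empty) tuple of OIE instances, $\mathcal F_o$ is a set of nonempty finite tuples of 2-tuples, $\mathcal I_o=\{\mathrm{bound}(T):T\in\mathcal F_o\}$, and $\mathcal A_o$ is a set of (labels of) atomic events. The void instance is $o_{\mathrm{void}}=((),\emptyset,\emptyset,\emptyset)$; every other instance has $\mathcal F_o,\mathcal I_o,\mathcal A_o$ nonempty. Two instances are equal iff all four components are equal. An index tuple of length $n$ is a tuple in which each of $1,\dots,n$ occurs exactly once. A permutation matrix $M$ acts on $n$-tuples (viewed as row vectors) on the right by reordering the entries, $T\mapsto T\cdot M$. For $S=\{o_1,\dots,o_n\}$ and an index tuple $\sigma=(i_1,\dots,i_n)$, let $N(S,\sigma)=\{(t_1,\dots,t_n):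 t_k\in\mathcal I_{o_{i_k}}\text{ for all }k\}$. External constraints determine an infeasible subset $\mathrm{Inf}(S,\sigma)\subseteq N(S,\sigma)$ (the infeasibility assignment); this is given data, subject only to the standing axiom: whenever $\sigma\cdot M=\tau$ for index tuples $\sigma,\tau$ of length $n>1$ and a permutation matrix $M$, the map $T\mapsto T\cdot M$ is a bijection from $\mathrm{Inf}(S,\sigma)$ onto $\mathrm{Inf}(S,\tau)$. Put $\mathrm{Feas}(S,\sigma)=N(S,\sigma)\setminus\mathrm{Inf}(S,\sigma)$. Ascending filter: for a set $X$ of tuples of 2-tuples, $\mathrm{Asc}(X)$ is the set of $T\in X$ such that for all positions $p<q$ the second item of the $p$-th entry of $T$ is $\le$ the first item of the $q$-th entry of $T$. Complete Sequence Multiplication $\otimes(o_{i_1},\dots,o_{i_n})$ ($\sigma=(i_1,\dots,i_n)$): the result is $o_{\mathrm{void}}$ if $\bigcap_{k}\mathcal A_{o_{i_k}}\ne\emptyset$, or some $o_{i_k}=o_{\mathrm{void}}$, or $\mathrm{Feas}(S,\sigma)=\emptyset$, or $\mathrm{Asc}(\mathrm{Feas}(S,\sigma))=\emptyset$. Otherwise the result is $(\mathcal C,\mathcal F,\mathcal I,\mathcal A)$ with $\mathcal C=(o_{i_1},\dots,o_{i_n})$, $\mathcal F=\mathrm{Asc}(\mathrm{Feas}(S,\sigma))$, $\mathcal I=\{\mathrm{bound}(T):T\in\mathcal F\}$, $\mathcal A=\bigcup_k\mathcal A_{o_{i_k}}$. Permutational equivalence: two non-void instances $o,o'$ are permutationally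 equivalent via a permutation matrix $M$ if $\mathcal C_o\cdot M=\mathcal C_{o'}$, $T\mapsto T\cdot M$ is a bijection from $\mathcal F_o$ onto $\mathcal F_{o'}$, $\mathcal I_o=\mathcal I_{o'}$ and $\mathcal A_o=\mathcal A_{o'}$. By convention $o_{\mathrm{void}}$ is permutationally equivalent to itself via any permutation matrix, and to no non-void instance. *)

(* Defs.v *)
From HB Require Import structures.
From mathcomp Require Import all_boot all_order all_algebra all_fingroup.
From mathcomp Require Import boolp classical_sets functions reals.

Set Implicit Arguments.
Unset Strict Implicit.
Unset Printing Implicit Defensive.

Import Order.TTheory GRing.Theory Num.Theory.
Local Open Scope classical_set_scope.
Local Open Scope ring_scope.

(* [M] is meant to be a permutation matrix; entry [j] of [t . M] is then the
   entry [i] of [t] for the unique [i] with [M i j = 1].  Entries of [t] need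
   not be scalars; [tuple_act_mulmx] below relates this to [*m]. *)
Definition tuple_act (n : nat) (M : 'M[int]_n) (X : Type) (t : n.-tuple X) :
    n.-tuple X :=
  [tuple tnth t (odflt j [pick i | M i j == 1]) | j < n].

(* Junk value: sequences whose length is not [n] are left unchanged. *)
Definition seq_act (n : nat) (M : 'M[int]_n) (X : Type) (s : seq X) : seq X :=
  if insub s is Some t then tval (tuple_act M (t : n.-tuple X)) else s.

Lemma tuple_act_mulmx (n : nat) (M : 'M[int]_n) (t : n.-tuple int) :
  is_perm_mx M ->
  \row_j tnth (tuple_act M t) j = (\row_j tnth t j) *m M.
Proof.
case/is_perm_mxP => s ->; apply/rowP => j.
rewrite !mxE tnth_mktuple (bigD1 ((s^-1)%g j)) //= !mxE permKV eqxx mulr1.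
rewrite big1 ?addr0 => [|i ne]; last first.
  rewrite !mxE; case: (s i =P j) => [sij|]; last by rewrite mulr0.
  by rewrite -sij permK eqxx in ne.
case: pickP => [i|/(_ ((s^-1)%g j))]; rewrite !mxE ?permKV ?eqxx //.
by case: (s i =P j) => // <-; rewrite permK.
Qed.

(* 0-based: positions 1, ..., n are represented by ['I_n]. *)
Definition index_tuple (n : nat) (s : n.-tuple 'I_n) : Prop :=
  forall i : 'I_n, count_mem i s = 1%N.

(* Only used on nonempty [T]; the head serves as the unit of min and max. *)
Definition bound (R : realType) (T : seq (R * R)) : R * R :=
  let h := head (0, 0) T in
  (\big[Order.min/h.1]_(p <- T) p.1, \big[Order.max/h.2]_(p <- T) p.2).

(* Raw 4-tuples over times [R] and labels [L]; see [is_oie] for the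
   conditions on the components. *)
Inductive oie (R : realType) (L : Type) : Type := OIE {
  comps : seq (oie R L);
  ftuples : set (seq (R * R));
  intervals : set (R * R);
  atoms : set L }.

Definition oie_void (R : realType) (L : Type) : oie R L :=
  OIE [::] set0 set0 set0.

Inductive is_oie (R : realType) (L : Type) : oie R L -> Prop :=
| is_oie_void : is_oie (oie_void R L)
| is_oie_nonvoid (C : seq (oie R L)) (F : set (seq (R * R))) (A : set L) :
    (forall i, (i < size C)%N -> is_oie (nth (oie_void R L) C i)) ->
    (forall T, F T -> T <> [::] /\ forall p, p \in T -> p.1 < p.2) ->
    F !=set0 -> A !=set0 ->
    is_oie (OIE C F [set bound T | T in F] A).

Definition Ntuples (R : realType) (L : Type) (n : nat) (o : 'I_n -> oie R L)
    (s : n.-tuple 'I_n) : set (n.-tuple (R * R)) :=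
  [set t | forall k, intervals (o (tnth s k)) (tnth t k)].

Definition infeasibility (R : realType) (L : Type) (n : nat)
    (o : 'I_n -> oie R L)
    (Inf : n.-tuple 'I_n -> set (n.-tuple (R * R))) : Prop :=
  (forall s, index_tuple s -> Inf s `<=` Ntuples o s) /\
  ((1 < n)%N -> forall (s t : n.-tuple 'I_n) (M : 'M[int]_n),
     index_tuple s -> index_tuple t -> is_perm_mx M -> tuple_act M s = t ->
     set_bij (Inf s) (Inf t) (fun T => tuple_act M T)).

Definition feas (R : realType) (L : Type) (n : nat) (o : 'I_n -> oie R L)
    (Inf : n.-tuple 'I_n -> set (n.-tuple (R * R))) (s : n.-tuple 'I_n) :
    set (seq (R * R)) :=
  [set tval t | t in Ntuples o s `\` Inf s].

Definition asc (R : realType) (X : set (seq (R * R))) : set (seq (R * R)) :=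
  [set T | X T /\ pairwise (fun p q : R * R => p.2 <= q.1) T].

Definition seq_mul (R : realType) (L : Type) (n : nat) (o : 'I_n -> oie R L)
    (Inf : n.-tuple 'I_n -> set (n.-tuple (R * R))) (s : n.-tuple 'I_n) :
    oie R L :=
  if `[< [\/ (\bigcap_(k in [set: 'I_n]) atoms (o (tnth s k))) !=set0,
             exists k, o (tnth s k) = oie_void R L,
             feas o Inf s = set0 |
             asc (feas o Inf s) = set0] >]
  then oie_void R L
  else OIE [seq o i | i <- s]
           (asc (feas o Inf s))
           [set bound T | T in asc (feas o Inf s)]
           (\bigcup_(k in [set: 'I_n]) atoms (o (tnth s k))).

(* The length conditions say that the products by [M] make sense; an empty
   tuple of components (an instance not built from others) is fixed by
   every [M]. *)
Definition perm_equiv (R : realType) (L : Type) (m : nat) (M : 'M[int]_m)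
    (o o' : oie R L) : Prop :=
  (o = oie_void R L /\ o' = oie_void R L) \/
  ((o <> oie_void R L /\ o' <> oie_void R L) /\
   [/\ (comps o = [::] \/ size (comps o) = m) /\
         seq_act M (comps o) = comps o',
       (forall T, ftuples o T -> size T = m) /\
         set_bij (ftuples o) (ftuples o') (fun T => seq_act M T),
       intervals o = intervals o' &
       atoms o = atoms o']).

(* Main.v *)
Require Import Defs.
From HB Require Import structures.
From mathcomp Require Import all_boot all_order all_algebra.
From mathcomp Require Import boolp classical_sets functions reals.

(** The ascending filter depends on the order of the operands, whereas a
    permutation matrix transports the unfiltered feasible tuples bijectively.
    Two events that can each happen in only one way, during [0, 1] and during
    [2, 3], with distinct atomic events and no external constraint, separate
    the two: multiplied in chronological order they yield an instance with one
    occurrence, while in the opposite order the only feasible tuple is not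
    ascending and the product is void.  The void instance is permutationally
    equivalent to no other instance, so no matrix relates the two products.

    The product of events with a single occurrence is computed for any number
    of operands: exactly one tuple is feasible ([feas_single_event]), hence the
    product is void when this tuple is not ascending
    ([seq_mul_single_event_void]), and it is not void when the tuple is
    ascending and two operands have different atoms
    ([seq_mul_single_event_nonvoid]). *)

Set Implicit Arguments.
Unset Strict Implicit.
Unset Printing Implicit Defensive.

Import Order.TTheory GRing.Theory Num.Theory.
Local Open Scope classical_set_scope.
Local Open Scope ring_scope.

Definition single_event (R : realType) (L : Type) (p : R * R) (c : L) :
    oie R L :=
  OIE [::] [set [:: p]] [set bound T | T in [set [:: p]]] [set c].

Lemma bound_seq1 (R : realType) (p : R * R) : bound [:: p] = p.
Proof. by rewrite /bound !big_cons !big_nil minxx maxxx; case: p. Qed.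

Lemma intervals_single_event (R : realType) (L : Type) (p : R * R) (c : L) :
  intervals (single_event p c) = [set p].
Proof. by rewrite /= image_set1 bound_seq1. Qed.

Lemma is_oie_single_event (R : realType) (L : Type) (p : R * R) (c : L) :
  p.1 < p.2 -> is_oie (single_event p c).
Proof.
move=> ltp; apply: is_oie_nonvoid => //.
- by move=> T ->; split=> // q; rewrite inE => /eqP ->.
- by exists [:: p].
- by exists c.
Qed.

Lemma single_event_nonvoid (R : realType) (L : Type) (p : R * R) (c : L) :
  single_event p c <> oie_void R L.
Proof.
move=> /(congr1 (@atoms R L)) /= c0.
by have : [set c] c by []; rewrite c0.
Qed.

Lemma single_event_inj (R : realType) (L : Type) (p q : R * R) (c d : L) :
  single_event p c = single_event q d -> c = d.
Proof.
move=> /(congr1 (@atoms R L)) /= cd.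
by have : [set c] c by []; rewrite cd.
Qed.

Lemma infeasibility_set0 (R : realType) (L : Type) (n : nat)
    (o : 'I_n -> oie R L) : infeasibility o (fun=> set0).
Proof.
split=> [s _ t [] // |_ s t M _ _ _ _].
by split=> [x [] | x y /set_mem [] | x []].
Qed.

Lemma perm_equiv_void (R : realType) (L : Type) (m : nat) (M : 'M[int]_m)
    (o : oie R L) : perm_equiv M o (oie_void R L) -> o = oie_void R L.
Proof. by case=> [[]//|[[_]]]. Qed.

(** Each interval set is a singleton, so an order of the operands admits a
    single tuple of intervals. *)
Lemma feas_single_event (R : realType) (L : Type) (n : nat)
    (p : 'I_n -> R * R) (c : 'I_n -> L) (s : n.-tuple 'I_n) :
  feas (fun k => single_event (p k) (c k)) (fun=> set0) s =
  [set [seq p i | i <- s]].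
Proof.
rewrite /feas setD0; apply/seteqP; split=> [_ [t Nt <-] | _ ->] /=.
  have -> : t = map_tuple p s; last by [].
  apply: eq_from_tnth => k; rewrite tnth_map.
  by have := Nt k; rewrite intervals_single_event.
exists (map_tuple p s) => // k.
by rewrite intervals_single_event tnth_map.
Qed.

Lemma seq_mul_single_event_void (R : realType) (L : Type) (n : nat)
    (p : 'I_n -> R * R) (c : 'I_n -> L) (s : n.-tuple 'I_n) :
  ~~ pairwise (fun q r : R * R => q.2 <= r.1) [seq p i | i <- s] ->
  seq_mul (fun k => single_event (p k) (c k)) (fun=> set0) s = oie_void R L.
Proof.
move=> /negP nasc; rewrite /seq_mul asboolT //.
apply: Or44; rewrite feas_single_event.
by apply/seteqP; split=> // T [-> /nasc].
Qed.

(** Common atoms of all operands would make the product void; two operands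
    with different atoms exclude this, because each has exactly one atom. *)
Lemma seq_mul_single_event_nonvoid (R : realType) (L : Type) (n : nat)
    (p : 'I_n -> R * R) (c : 'I_n -> L) (s : n.-tuple 'I_n) (i j : 'I_n) :
  pairwise (fun q r : R * R => q.2 <= r.1) [seq p i | i <- s] ->
  c (tnth s i) <> c (tnth s j) ->
  seq_mul (fun k => single_event (p k) (c k)) (fun=> set0) s <> oie_void R L.
Proof.
move=> ascs cij; rewrite /seq_mul asboolF.
  move=> /(congr1 (@atoms R L)) /= c0.
  suff : (set0 : set L) (c (tnth s i)) by [].
  by rewrite -c0; exists i.
rewrite feas_single_event => -[[d cd]|[k]|e0|e0].
- by apply: cij; rewrite -(cd i I) -(cd j I).
- exact: single_event_nonvoid.
- by have : [set [seq p i | i <- s]] [seq p i | i <- s] by []; rewrite e0.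
- have : asc [set [seq p i | i <- s]] [seq p i | i <- s] by split.
  by rewrite e0.
Qed.

Theorem mainTheorem3 (R : realType) (L : Type) (a b : L) (hab : a <> b) :
  exists (n : nat) (o : 'I_n -> oie R L)
         (Inf : n.-tuple 'I_n -> set (n.-tuple (R * R)%type))
         (s t : n.-tuple 'I_n),
    ((0 < n)%N /\ injective o /\ (forall k, is_oie (o k)) /\
       infeasibility o Inf) /\
    (index_tuple s /\ index_tuple t) /\
    (forall (m : nat) (M : 'M[int]_m), is_perm_mx M ->
       ~ perm_equiv M (seq_mul o Inf s) (seq_mul o Inf t)).
Proof.
(* Event k takes place during [2k, 2k + 1]. *)
pose p (k : 'I_2) : R * R := (k.*2%:R, k.*2.+1%:R).
pose c (k : 'I_2) : L := if k == ord0 then a else b.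
have c_inj : injective c.
  move=> i j; rewrite /c => cij; apply/val_inj; move: cij.
  case: i => [[|[|//]] i2]; case: j => [[|[|//]] j2] //= e;
    by case: hab; rewrite e.
exists 2, (fun k => single_event (p k) (c k)), (fun=> set0).
exists [tuple ord0; ord_max], [tuple ord_max; ord0].
split; [split=> //; split; [|split] | split; [split|]].
- by move=> i j eij; apply: c_inj; exact: single_event_inj eij.
- by move=> k; apply: is_oie_single_event; rewrite ltr_nat.
- exact: infeasibility_set0.
- by move=> [[|[|//]] i2].
- by move=> [[|[|//]] i2].
move=> m M _; rewrite [X in perm_equiv _ _ X]seq_mul_single_event_void.
  move=> /perm_equiv_void.
  apply: (seq_mul_single_event_nonvoid (i := ord0) (j := ord_max)).
    by rewrite /= !andbT ler_nat.
  by move=> /c_inj /(congr1 val).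
by rewrite /= !andbT ler_nat.
Qed.
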